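(* Consider a GAN game with objective $V$ and let $\lambda\ge 0$. For every $\lambda$-proximal equilibrium $(\theta_d^*,\theta_g^* )$ of the game, $$V_{D_w}(\theta_g^* )=V^{\lambda}_{G_w}(\theta_d^* )=V^{\lambda}(D_{\theta_d^*},G_{\theta_g^*}),$$ and thus $DG^{\lambda}(\theta_d^*,\theta_g^* )=0$.
   Context: A GAN game is $\min_{\theta_g\in\Theta_G}\max_{\theta_d\in\Theta_D}V(D_{\theta_d},G_{\theta_g})$, where $V$ is a real-valued objective function, $\theta_d$ parametrizes a discriminator $D_{\theta_d}$ (a function on the data space) and $\theta_g$ parametrizes a generator $G_{\theta_g}$. Let $\|\cdot\|$ be a fixed norm (or seminorm) on discriminators. The proximal objective is $$V^{\lambda}(D_{\theta_d},G_{\theta_g})=\max_{\tilde\theta_d\in\Theta_D}\{V(D_{\tilde\theta_d},G_{\theta_g})-\lambda\|D_{\tilde\theta_d}-D_{\theta_d}\|^2\}.$$ A configuration $(\theta_d^*,\theta_g^* )$ is a $\lambda$-proximal equilibrium if for all $\theta_d\in\Theta_D$, $\theta_g\in\Theta_G$, $V(D_{\theta_d},G_{\theta_g^*})\le V(D_{\theta_d^*},G_{\theta_g^*})\le V^{\lambda}(D_{\theta_d^*},G_{\theta_g})$. The proximal duality gap is $DG^{\lambda}(\theta_d,\theta_g)=V_{D_w}(\theta_g)-V^{\lambda}_{G_w}(\theta_d)$, where $V_{D_w}(\theta_g)=\max_{\theta_d'\in\Theta_D}V(D_{\theta_d'},G_{\theta_g})$ and $V^{\lambda}_{G_w}(\theta_d)=\min_{\theta_g'\in\Theta_G}V^{\lambda}(D_{\theta_d},G_{\theta_g'})$.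 All displayed maxima and minima are assumed to exist. *)

(* Defs.v *)
From mathcomp Require Import all_boot all_order all_algebra.
From mathcomp Require Import boolp classical_sets functions reals.

Set Implicit Arguments.
Unset Strict Implicit.
Unset Printing Implicit Defensive.

Import Order.TTheory GRing.Theory Num.Theory.
Local Open Scope classical_set_scope.
Local Open Scope ring_scope.

(* [set_max A] is meaningful only under [has_max A]; otherwise it is 0.
   Likewise for [set_min]. *)
Definition has_max (R : realType) (A : set R) : Prop := A `&` ubound A !=set0.
Definition has_min (R : realType) (A : set R) : Prop := A `&` lbound A !=set0.
Definition set_max (R : realType) (A : set R) : R := xget 0 (A `&` ubound A).
Definition set_min (R : realType) (A : set R) : R := xget 0 (A `&` lbound A).

(* Nothing is assumed about the form of the generators, so they form an
   arbitrary type. Discriminators take values in a vector space, e.g. [R^o]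
   for the scalar-valued ones. The values of [disc] and [gen] outside of the
   admissible sets [ThetaD] and [ThetaG] are never used. *)
Record gan_game (R : realType) := GanGame {
  data : Type ;
  output : lmodType R ;
  generator : Type ;
  disc_param : Type ;
  gen_param : Type ;
  ThetaD : set disc_param ;
  ThetaG : set gen_param ;
  disc : disc_param -> (data -> output) ;
  gen : gen_param -> generator ;
  objective : (data -> output) -> generator -> R
}.

(* A norm such as an L^2 or Sobolev norm makes sense only for some functions,
   so [N] is required to be a seminorm only on a subspace [F] that contains
   all the discriminators of the game. A norm is a particular case. *)
Record disc_seminorm (R : realType) (game : gan_game R)
    (F : {pred data game -> output game})
    (N : (data game -> output game) -> R) : Prop := DiscSeminorm {
  disc_subspace : submod_closed F ;
  disc_in_subspace : forall t, ThetaD t -> disc t \in F ;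
  disc_seminormD : {in F &, forall f g, N (f + g) <= N f + N g} ;
  disc_seminormZ : forall a : R, {in F, forall f, N (a *: f) = `|a| * N f}
}.

Section ProximalGame.
Variables (R : realType) (game : gan_game R).
Variables (N : (data game -> output game) -> R) (lambda : R).

Local Notation V := (@objective R game).
Local Notation D := (@disc R game).
Local Notation G := (@gen R game).
Local Notation TD := (@ThetaD R game).
Local Notation TG := (@ThetaG R game).

Definition prox_values D0 G0 : set R :=
  [set V (D t) G0 - lambda * N (D t - D0) ^+ 2 | t in TD].

Definition prox_objective D0 G0 : R := set_max (prox_values D0 G0).

Definition worst_disc_values g : set R := [set V (D t) (G g) | t in TD].

Definition worst_disc g : R := set_max (worst_disc_values g).

Definition prox_worst_gen_values d : set R :=
  [set prox_objective (D d) (G t) | t in TG].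

Definition prox_worst_gen d : R := set_min (prox_worst_gen_values d).

Definition prox_duality_gap d g : R := worst_disc g - prox_worst_gen d.

Definition prox_equilibrium d g : Prop :=
  [/\ TD d, TG g &
      forall d' g', TD d' -> TG g' ->
        V (D d') (G g) <= V (D d) (G g) /\
        V (D d) (G g) <= prox_objective (D d) (G g')].

(* The second clause is the outer minimum of the game itself. *)
Definition extrema_exist : Prop :=
  [/\ forall g, TG g -> has_max (worst_disc_values g),
      has_min [set worst_disc g | g in TG],
      forall d g, TD d -> TG g -> has_max (prox_values (D d) (G g)) &
      forall d, TD d -> has_min (prox_worst_gen_values d)].

End ProximalGame.

(* Main.v *)
(** At an equilibrium [d] is a best response to [g], so [V (D d) (G g)] is the
    unpenalized maximum. The penalty is nonnegative, so the proximal maximum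
    cannot exceed it, and the second equilibrium inequality at [g' := g] gives
    the converse. The same inequality at arbitrary [g'] then says that [g]
    minimizes the proximal objective. *)
Require Import Defs.
From mathcomp Require Import all_boot all_order all_algebra.
From mathcomp Require Import boolp classical_sets functions reals.

Import Order.TTheory GRing.Theory Num.Theory.
Local Open Scope ring_scope.

Lemma set_maxP (R : realType) (A : set R) :
  has_max A -> A (set_max A) /\ ubound A (set_max A).
Proof. by case=> x Ax; exact: (xgetI 0 Ax). Qed.

(** A maximum is unique by antisymmetry, so any witness determines the value that [xget] picks. *)
Lemma set_max_eq (R : realType) (A : set R) (x : R) :
  A x -> ubound A x -> set_max A = x.
Proof.
move=> Ax ubx; have [|Am ubm] := @set_maxP _ A; first by exists x.
by apply/le_anti; rewrite ubx // ubm.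
Qed.

Lemma set_min_eq (R : realType) (A : set R) (x : R) :
  A x -> lbound A x -> set_min A = x.
Proof.
move=> Ax lbx; have [Am lbm] := xgetI 0 (conj Ax lbx : setI A (lbound A) x).
by apply/le_anti; rewrite lbm // lbx.
Qed.

Section Equilibrium.
Context (R : realType) (game : gan_game R).
Context (N : (data game -> output game) -> R) (lambda : R).
Context (d : disc_param game) (g : gen_param game).
Hypothesis heq : prox_equilibrium N lambda d g.

Lemma worst_disc_equilibrium : worst_disc g = objective (disc d) (gen g).
Proof.
case: heq => Dd Gg hdg; apply: set_max_eq; first by exists d.
by move=> _ [t Dt <-]; have [] := hdg t g Dt Gg.
Qed.

Lemma prox_objective_equilibrium :
    0 <= lambda -> has_max (prox_values N lambda (disc d) (gen g)) ->
  prox_objective N lambda (disc d) (gen g) = objective (disc d) (gen g).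
Proof.
(* Let [t] attain the proximal maximum: bounding its single penalized value by [V (D d) (G g)] then
   suffices. *)
case: heq => Dd Gg hdg lambda_ge0 /set_maxP[[t Dt maxE] _].
have [Vtd Vle] := hdg t g Dt Gg.
apply/le_anti; rewrite Vle andbT /prox_objective -maxE.
by apply: le_trans Vtd; rewrite gerBl mulr_ge0 ?sqr_ge0.
Qed.

Lemma prox_worst_gen_equilibrium :
    0 <= lambda -> has_max (prox_values N lambda (disc d) (gen g)) ->
  prox_worst_gen N lambda d = objective (disc d) (gen g).
Proof.
move=> lambda_ge0 hmax; case: heq => Dd Gg hdg; apply: set_min_eq.
  by exists g => //; exact: prox_objective_equilibrium.
(* The second equilibrium inequality does not mention the deviating discriminator, so [d] fills that
   slot. *)
by move=> _ [t Gt <-]; have [] := hdg d t Dd Gt.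
Qed.

End Equilibrium.

Theorem mainTheorem5 (R : realType) (game : gan_game R)
    (F : {pred data game -> output game})
    (N : (data game -> output game) -> R) (lambda : R)
    (hN : disc_seminorm F N) (hlambda : 0 <= lambda)
    (hex : extrema_exist N lambda)
    (d : disc_param game) (g : gen_param game)
    (heq : prox_equilibrium N lambda d g) :
  [/\ worst_disc g = prox_worst_gen N lambda d,
      prox_worst_gen N lambda d = prox_objective N lambda (disc d) (gen g) &
      prox_duality_gap N lambda d g = 0].
Proof.
(* This ensures that [prox_objective] at the equilibrium is a genuine maximum and not the default
   0. *)
have hmax : has_max (prox_values N lambda (disc d) (gen g)).
  by case: hex heq => _ _ hmax _ [Dd Gg _]; exact: hmax.
have worstE := worst_disc_equilibrium _ _ _ _ _ _ heq.
have minE := prox_worst_gen_equilibrium _ _ _ _ _ _ heq hlambda hmax.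
have proxE := prox_objective_equilibrium _ _ _ _ _ _ heq hlambda hmax.
by split; rewrite /prox_duality_gap ?worstE ?minE ?proxE ?subrr.
Qed.
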